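(* Let $U,V\in\mathbb{R}^n$ be random vectors whose coordinate pairs $(U_i,V_i)\in\mathbb{R}^2$, $i=1,\ldots,n$, are i.i.d. with $\mathbb{E}(U_i^4)<\infty$ and $\mathbb{E}(V_i^4)<\infty$, and let $\Pi$ be a random matrix independent of $(U,V)$. Let $m=m_n\to\infty$ with $m/n\to0$ as $n\to\infty$. (i) If $\Pi$ is a random sampling with replacement matrix with sampling probabilities $p_1,\ldots,p_n$ satisfying $\sum_{i=1}^n p_i^2=o(m^{-1})$, then as $n\to\infty$, $\mathrm{MSE}\left[\sqrt{m}\,(U^T\Pi^T\Pi V-U^TV)/n\right]\to\mathrm{Var}(U_iV_i)$. (ii) If $\Pi$ is a Bernoulli sampling matrix, then as $n\to\infty$, $\mathrm{MSE}\left[\sqrt{m}\,(U^T\Pi^T\Pi V-U^TV)/n\right]\to\mathbb{E}(U_i^2V_i^2)$.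
   Context: For a random variable $G$, $\mathrm{MSE}(G):=[\mathbb{E}(G)]^2+\mathrm{Var}(G)$. Random sampling with replacement (RS): for deterministic probabilities $p_1,\dots,p_n\ge0$ with $\sum_i p_i=1$, draw $k_1,\ldots,k_m$ independently from $\{1,\ldots,n\}$ with $\Pr(k_t=i)=p_i$, and set $\Pi=\sqrt{n/m}\,(\iota_{k_1},\ldots,\iota_{k_m})^T\in\mathbb{R}^{m\times n}$, where $\iota_k$ is the $k$-th column of the $n\times n$ identity matrix. Bernoulli sampling (BS): $\Pi=\sqrt{n/m}\,B$ where $B$ is an $n\times n$ diagonal matrix with i.i.d. Bernoulli$(m/n)$ diagonal entries. *)

(* Defs.v *)
From HB Require Import structures.
From mathcomp Require Import all_boot all_order all_algebra.
From mathcomp Require Import all_classical all_reals all_analysis.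
Set Implicit Arguments. Unset Strict Implicit. Unset Printing Implicit Defensive.
Import Order.TTheory GRing.Theory Num.Theory.
Import numFieldNormedType.Exports.
Local Open Scope classical_set_scope.
Local Open Scope ring_scope.

Section Defs.
Context {R : realType}.

Definition MSE d (T : measurableType d) (P : probability T R) (G : T -> R)
  : \bar R := ('E_P[G] * 'E_P[G] + 'V_P[G])%E.

Definition RS_matrix (n m : nat) (k : 'I_m -> 'I_n) : 'M[R]_(m, n) :=
  Num.sqrt (n%:R / m%:R) *: \matrix_(t < m, i < n) ((k t == i)%:R : R).

Definition BS_matrix (n m : nat) (b : 'I_n -> bool) : 'M[R]_n :=
  Num.sqrt (n%:R / m%:R) *: diag_mx (\row_(i < n) ((b i)%:R : R)).

Definition sketch_stat (n m p : nat) (Pi : 'M[R]_(p, n)) (U V : 'cV[R]_n) : R :=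
  Num.sqrt (m%:R) * ((U^T *m Pi^T *m Pi *m V) ord0 ord0 - (U^T *m V) ord0 ord0)
  / n%:R.

(* Joint law for (i): the pairs (U_i,V_i), i < n, are i.i.d. with law mu,
   the indices k_1..k_m are i.i.d. with Pr(k_t = i) = p_i, and the family
   (k_t)_t is independent of (U_i,V_i)_i.  Stated as the product rule on all
   (measurable) rectangles of the joint law. *)
Definition RS_joint_law d (T : measurableType d) (P : probability T R)
  (mu : probability (R * R)%type R) (n m : nat)
  (U V : 'I_n -> T -> R) (p : 'I_n -> R) (k : 'I_m -> T -> 'I_n) : Prop :=
  forall (A : 'I_n -> set (R * R)%type) (j : 'I_m -> 'I_n),
    (forall i, measurable (A i)) ->
    P [set w | (forall i, A i (U i w, V i w)) /\ (forall t, k t w = j t)] =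
    ((\prod_(i < n) mu (A i)) * (\prod_(t < m) (p (j t))%:E))%E.

(* Joint law for (ii): pairs i.i.d. with law mu, b_1..b_n i.i.d.
   Bernoulli(q), independent of the pairs. *)
Definition BS_joint_law d (T : measurableType d) (P : probability T R)
  (mu : probability (R * R)%type R) (n : nat) (q : R)
  (U V : 'I_n -> T -> R) (b : 'I_n -> T -> bool) : Prop :=
  forall (A : 'I_n -> set (R * R)%type) (c : 'I_n -> bool),
    (forall i, measurable (A i)) ->
    P [set w | (forall i, A i (U i w, V i w)) /\ (forall i, b i w = c i)] =
    ((\prod_(i < n) mu (A i)) *
       (\prod_(i < n) (if c i then q else 1 - q)%:E))%E.

End Defs.

(* Main.v *)
(** Writing [Y_i = U_i V_i], the statistic is a weighted sum [\sum_i W_i Y_i]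
    whose weights depend only on the sampling outcome, so
    [MSE = E[(\sum_i W_i Y_i)^2]
         = Var(Y) * E[\sum_i W_i^2] + E[Y]^2 * E[(\sum_i W_i)^2]].
    With replacement, [\sum_i W_i = 0] surely and
    [E[\sum_i W_i^2] = 1 + (m - 1) \sum_i p_i^2 - m / n], which tends to 1.
    For Bernoulli sampling both expectations equal [1 - m / n], so the MSE is
    [E[Y^2] * (1 - m / n)]. *)

Require Import Defs.
From HB Require Import structures.
From mathcomp Require Import all_boot all_order all_algebra.
From mathcomp Require Import all_classical all_reals all_analysis.
From mathcomp Require Import measurable_realfun ring lra.
Import Order.TTheory GRing.Theory Num.Theory.
Import numFieldNormedType.Exports.
Local Open Scope classical_set_scope.
Local Open Scope ring_scope.

(** * Independence and integrals of products *)

(** Independence says that the joint law of [f] and [g] is the product of their laws, so Fubini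
    factorises the integral of [x * y]. Integrability is obtained first, from Tonelli applied to
    [|x * y|]. *)
Lemma integral_mul_indep {R : realType} {d : measure_display}
  {T : measurableType d} (P : probability T R) (f g : T -> R) :
  measurable_fun setT f -> measurable_fun setT g ->
  P.-integrable setT (EFin \o f) -> P.-integrable setT (EFin \o g) ->
  (forall A B, measurable A -> measurable B ->
     P (f @^-1` A `&` g @^-1` B) = P (f @^-1` A) * P (g @^-1` B))%E ->
  P.-integrable setT (EFin \o (f \* g)) /\
  (\int[P]_w (f w * g w)%:E = \int[P]_w (f w)%:E * \int[P]_w (g w)%:E)%E.
Proof.
move=> mf mg intf intg fgP.
pose X : {RV P >-> R} := HB.pack f (isMeasurableFun.Build _ _ _ _ _ mf).
pose Y : {RV P >-> R} := HB.pack g (isMeasurableFun.Build _ _ _ _ _ mg).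
pose m1 := distribution P X; pose m2 := distribution P Y.
have mZ : measurable_fun setT (fun w => (f w, g w)).
  exact: measurable_fun_pair.
pose Z : {RV P >-> (R * R)%type} :=
  HB.pack (fun w => (f w, g w)) (isMeasurableFun.Build _ _ _ _ _ mZ).
(* Agreement on rectangles determines the product measure, so the product rule assumed for [f] and
   [g] is enough. *)
have mE A : measurable A -> (m1 \x m2)%E A = distribution P Z A.
  move=> mA; exact: product_measure_unique.
have mxy : measurable_fun setT (fun z : (R * R)%type => (z.1 * z.2)%:E).
  by apply/measurable_EFinP; apply: measurable_funM.
have intE h : (\int[distribution P Z]_z h z = \int[(m1 \x m2)%E]_z h z)%E.
  by apply: eq_measure_integral => A mA _; exact/esym/mE.
have intX : (\int[m1]_x `|x|%:E = \int[P]_w `|f w|%:E)%E.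
  rewrite ge0_integral_distribution//; apply/measurable_EFinP.
  exact: normr_measurable.
have intY : (\int[m2]_x `|x|%:E = \int[P]_w `|g w|%:E)%E.
  rewrite ge0_integral_distribution//; apply/measurable_EFinP.
  exact: normr_measurable.
have intXY : (m1 \x m2)%E.-integrable setT (fun z : (R * R)%type => (z.1 * z.2)%:E).
  apply/integrable12ltyP => //.
  have inner x : (\int[m2]_y `|(x * y)%:E| = `|x|%:E * \int[P]_w `|g w|%:E)%E.
    rewrite -intY -ge0_integralZl//; last first.
      by apply/measurable_EFinP; exact: normr_measurable.
    by apply: eq_integral => y _; rewrite -EFinM -normrM.
  under eq_integral => x _ do rewrite inner.
  have /integrableP[_ fi] := intf. have /integrableP[_ gi] := intg.
  have gfin : (\int[P]_w `|g w|%:E)%E \is a fin_num.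
    by rewrite ge0_fin_numE// integral_ge0.
  rewrite -(fineK gfin) ge0_integralZr//.
  - rewrite intX lte_mul_pinfty ?integral_ge0 ?ltry//.
    by rewrite ge0_fin_numE// integral_ge0.
  - by apply/measurable_EFinP; exact: normr_measurable.
  - by rewrite fineK// integral_ge0.
have intfg : P.-integrable setT (EFin \o (f \* g)).
  apply/integrableP; split.
    by apply/measurable_EFinP; apply: measurable_funM.
  have /integrableP[_] := intXY.
  rewrite -intE ge0_integral_distribution//.
  exact: measurableT_comp.
split => //.
have <- : (\int[distribution P Z]_z (z.1 * z.2)%:E = \int[P]_w (f w * g w)%:E)%E.
  by rewrite integral_distribution.
rewrite intE -integral12_prod_meas1// /fubini_F.
have dX : m1.-integrable setT EFin.
  by apply: integrable_pushforward.
have dY : m2.-integrable setT EFin.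
  by apply: integrable_pushforward.
have inner x : (\int[m2]_y (x * y)%:E = x%:E * \int[m2]_y y%:E)%E.
  by rewrite -integralZl.
under eq_integral => x _ do rewrite inner.
have fY : (\int[m2]_x x%:E)%E \is a fin_num by apply: integrable_fin_num.
rewrite -(fineK fY) integralZr// fineK//.
rewrite /= !integral_distribution//.
Qed.

Lemma probability_setD_indep {R : realType} {d : measure_display}
  {T : measurableType d} (P : probability T R) (D E : set T) :
  measurable D -> measurable E -> (P (D `&` E) = P D * P E)%E ->
  (P (E `\` D) = P (~` D) * P E)%E.
Proof.
move=> mD mE DE.
have Pfin A : measurable A -> P A \is a fin_num.
  by move=> mA; exact: fin_num_measure.
rewrite measureD//; last by rewrite ltey_eq Pfin.
transitivity (P E - P D * P E)%E.
  by congr (_ - _)%E; rewrite setIC.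
by rewrite probability_setC// muleBl ?mul1e ?Pfin// fin_num_adde_defl// Pfin.
Qed.

(** Two uses of the factorisation for independent pairs: first for [\1_D] and [f], then for
    [\1_D * f] and [g]. The second requires the product rule for the preimages of [\1_D * f]. *)
Lemma integral_indic_mul_indep {R : realType} {d : measure_display}
  {T : measurableType d} (P : probability T R) (D : set T) (f g : T -> R) :
  measurable D -> measurable_fun setT f -> measurable_fun setT g ->
  P.-integrable setT (EFin \o f) -> P.-integrable setT (EFin \o g) ->
  (forall A B, measurable A -> measurable B ->
     P (D `&` (f @^-1` A `&` g @^-1` B)) =
     P D * (P (f @^-1` A) * P (g @^-1` B)))%E ->
  P.-integrable setT (EFin \o (fun w => \1_D w * (f w * g w))) /\
  (\int[P]_w (\1_D w * (f w * g w))%:E =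
   P D * (\int[P]_w (f w)%:E * \int[P]_w (g w)%:E))%E.
Proof.
move=> mD mf mg intf intg fgP.
have mfA A : measurable A -> measurable (f @^-1` A).
  by move=> mA; rewrite -[X in measurable X]setTI; exact: mf.
have mgA A : measurable A -> measurable (g @^-1` A).
  by move=> mA; rewrite -[X in measurable X]setTI; exact: mg.
(* Putting the whole line in place of one of the two sets leaves the independence of [D] from [f]
   alone, and then from [g] alone. *)
have fP A : measurable A -> (P (D `&` f @^-1` A) = P D * P (f @^-1` A))%E.
  move=> mA; have := fgP A setT mA measurableT.
  by rewrite preimage_setT setIT probability_setT mule1.
have gP A : measurable A -> (P (D `&` g @^-1` A) = P D * P (g @^-1` A))%E.
  move=> mA; have := fgP setT A measurableT mA.
  by rewrite preimage_setT setTI probability_setT mul1e.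
pose Df : T -> R := fun w => \1_D w * f w.
have mDf : measurable_fun setT Df.
  by apply: measurable_funM => //; exact: measurable_indic.
(* [\1_D * f] takes the value [0] off [D], whence the case [A 0]. *)
have split1 (A : set R) (E : set T) : measurable A -> measurable E ->
    (P (Df @^-1` A `&` E) =
     P (D `&` (f @^-1` A `&` E)) + (if 0%R \in A then P (E `\` D) else 0))%E.
  move=> mA mE; case: ifPn => A0.
    rewrite -measureU//; first last.
    - by rewrite -subset0 => w [[Dw _] []].
    - exact: measurableD.
    - by apply: measurableI => //; apply: measurableI => //; exact: mfA.
    congr (P _); apply/seteqP; split => w /=.
      rewrite /Df indicE; have [wD|wD] := boolP (w \in D).
        by rewrite mul1r => -[fA Ew]; left; split => //; rewrite inE in wD.
      by move=> [_ Ew]; right; split => //; rewrite notin_setE in wD.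
    rewrite /Df indicE => -[[Dw [fA Ew]]|[Ew Dw]].
      by rewrite mem_set// mul1r.
    by rewrite memNset// mul0r; split => //; rewrite inE in A0.
  rewrite adde0; congr (P _); apply/seteqP; split => w /=.
    rewrite /Df indicE; have [wD|wD] := boolP (w \in D).
      by rewrite mul1r => -[fA Ew]; split => //; rewrite inE in wD.
    by rewrite mul0r => -[] A0'; rewrite notin_setE in A0.
  by rewrite /Df indicE => -[Dw [fA Ew]]; rewrite mem_set// mul1r.
have PfinD E : measurable E -> P E \is a fin_num by move=> mE; exact: fin_num_measure.
have [iDf EDf] : P.-integrable setT (EFin \o (\1_D \* f)) /\
    (\int[P]_w (\1_D w * f w)%:E = P D * \int[P]_w (f w)%:E)%E.
  have [|||||i e] := @integral_mul_indep R d T P \1_D f.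
  - exact: measurable_indic.
  - exact: mf.
  - exact: integrable_indic.
  - exact: intf.
  - move=> A B mA mB.
    have mA' : measurable (\1_D @^-1` A : set T).
      rewrite -[X in measurable X]setTI.
      by apply: (measurable_indic mD) => //.
    rewrite preimage_indic.
    case: ifPn => A1; case: ifPn => A0.
    + by rewrite setTI probability_setT mul1e.
    + exact: fP.
    + rewrite setIC -setDE probability_setD_indep//; first exact: mfA.
      exact: fP.
    + by rewrite set0I measure0 mul0e.
  split; first exact: i.
  rewrite e; congr (_ * _)%E.
  by rewrite integral_indic// setIT.
have [] := @integral_mul_indep R d T P Df g mDf mg iDf intg.
  move=> A B mA mB.
  (* The same splitting with [E] the whole space; each of the two pieces then factors against the
     preimage under [g]. *)
  have -> : (P (Df @^-1` A) =
     P (D `&` f @^-1` A) + (if 0%R \in A then P (~` D) else 0))%E.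
    have := split1 A setT mA measurableT; rewrite !setIT => ->.
    by rewrite setTD.
  rewrite split1//; last exact: mgA.
  rewrite fgP// fP// muleDl; last 2 first.
  - by rewrite PfinD//; exact: mgA.
  - by rewrite fin_num_adde_defr// fin_numM// PfinD//; exact: mfA.
  rewrite muleA; congr (_ + _)%E.
  case: ifP => _; last by rewrite mul0e.
  rewrite probability_setD_indep//; first exact: mgA.
  exact: gP.
move=> i e; split.
  by apply: eq_integrable i => // w _ /=; rewrite mulrA.
under eq_integral => w _ do rewrite mulrA.
by rewrite e EDf muleA.
Qed.

(** * Second moments and the mean squared error *)

(** Since [(|x| - 1)^2 >= 0], [|x| <= 1 + x^2], and constants are integrable under a probability
    measure. *)
Lemma integrable_of_sqr {R : realType} {d : measure_display}
  {T : measurableType d} (P : probability T R) (f : T -> R) :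
  measurable_fun setT f -> P.-integrable setT (EFin \o (fun x => f x ^+ 2)) ->
  P.-integrable setT (EFin \o f).
Proof.
move=> mf if2.
have i1 : P.-integrable setT (EFin \o cst (1 : R)).
  exact: finite_measure_integrable_cst.
apply: le_integrable (integrableD measurableT i1 if2) => //.
  exact/measurable_EFinP.
move=> x _ /=; rewrite lee_fin.
rewrite [leRHS]ger0_norm; last by rewrite addr_ge0 ?sqr_ge0.
rewrite -[f x ^+ 2]real_normK ?num_real//.
have := sqr_ge0 (`|f x| - 1); have := normr_ge0 (f x); nra.
Qed.

(** The variance is the second moment minus the squared mean; the mean is finite, so the squared
    means cancel in the extended reals. *)
Lemma MSE_sqr {R : realType} {d : measure_display} {T : measurableType d}
  (P : probability T R) (G : T -> R) :
  measurable_fun setT G -> P.-integrable setT (EFin \o (fun w => G w ^+ 2)) ->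
  MSE P G = (\int[P]_w (G w ^+ 2)%:E)%E.
Proof.
move=> mG iG2; have iG := integrable_of_sqr P G mG iG2.
have EG : 'E_P[G]%E \is a fin_num.
  by apply: expectation_fin_num; exact/Lfun1_integrable.
rewrite /MSE /variance covarianceE.
- rewrite addeCA subee ?fin_numM// adde0.
  by rewrite unlock.
- exact/Lfun1_integrable.
- exact/Lfun1_integrable.
- exact/Lfun1_integrable.
Qed.

(** * I.i.d. data with an independent finite-valued mark, a common model of both sampling schemes *)

Section discrete_mark.
Context {R : realType} {d dS : measure_display} {T : measurableType d}
  {S : measurableType dS} (P : probability T R) (mu : probability S R)
  {n : nat} {K : finType} (X : 'I_n -> T -> S) (kappa : T -> K) (r : K -> R).
Hypothesis mX : forall i, measurable_fun setT (X i).
Hypothesis mkappa : forall c, measurable (kappa @^-1` [set c]).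
Hypothesis law : forall (A : 'I_n -> set S) (c : K),
  (forall i, measurable (A i)) ->
  P [set w | (forall i, A i (X i w)) /\ kappa w = c] =
  ((\prod_(i < n) mu (A i)) * (r c)%:E)%E.

Let mpre i A : measurable A -> measurable (X i @^-1` A).
Proof. by move=> mA; rewrite -[X in measurable X]setTI; exact: mX. Qed.

(** [law] is applied with every set equal to the whole space; the next two lemmas leave only one or
    two sets free. *)
Lemma probability_fiber c : P (kappa @^-1` [set c]) = (r c)%:E.
Proof.
have := law (fun=> setT) c (fun=> measurableT).
rewrite big1 ?mul1e; last by move=> i _; exact: probability_setT.
by move=> <-; congr (P _); apply/seteqP; split => w //= [].
Qed.

Lemma probability_fiber1 i c A : measurable A ->
  P (kappa @^-1` [set c] `&` X i @^-1` A) = ((r c)%:E * mu A)%E.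
Proof.
move=> mA.
have /= := law (fun j => if j == i then A else setT) c.
rewrite (bigD1 i)//= eqxx big1 ?mule1; last first.
  by move=> j /negPf ->; exact: probability_setT.
rewrite muleC => <-; last by move=> j; case: ifP.
congr (P _); apply/seteqP; split => w /=.
  by move=> [kw Aw]; split => // j; case: eqVneq => // ->.
by move=> [/(_ i)]; rewrite eqxx.
Qed.

Lemma probability_fiber2 i l c A B : i != l -> measurable A -> measurable B ->
  P (kappa @^-1` [set c] `&` (X i @^-1` A `&` X l @^-1` B)) =
  ((r c)%:E * (mu A * mu B))%E.
Proof.
move=> il mA mB.
have li : l == i = false by rewrite eq_sym (negPf il).
have /= := law (fun j => if j == i then A else if j == l then B else setT) c.
rewrite (bigD1 i)//= eqxx (bigD1 l) ?li//= eqxx big1 ?mule1; last first.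
  by move=> j /andP[/negPf -> /negPf ->]; exact: probability_setT.
rewrite muleC => <-; last by move=> j; case: ifP => //; case: ifP.
congr (P _); apply/seteqP; split => w /=.
  move=> [kw [Aw Bw]]; split => // j; case: eqVneq => [->//|_].
  by case: eqVneq => // ->.
by move=> [h kw]; split => //; split; [have := h i|have := h l];
  rewrite ?li eqxx.
Qed.

Lemma probability_marginal i A : measurable A -> P (X i @^-1` A) = mu A.
Proof.
move=> mA.
(* The fibres of the mark partition the space, so the indicator of [E] is a finite sum of
   indicators. *)
have sumP E : measurable E -> P E = (\sum_c P (kappa @^-1` [set c] `&` E))%E.
  move=> mE; rewrite -[E in LHS]setIT -integral_indic//.
  under [RHS]eq_bigr => c _.
    rewrite -[X in P X]setIT -integral_indic//; last exact: measurableI.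
    over.
  rewrite -ge0_integral_sum//; last first.
    move=> c; apply/measurable_EFinP; apply: measurable_indic.
    exact: measurableI.
  apply: eq_integral => w _; rewrite sumEFin; congr EFin.
  rewrite (bigD1 (kappa w))//= big1 ?addr0 => [|c cw].
    rewrite !indicE in_setI (_ : w \in kappa @^-1` _)//.
    by apply/mem_set.
  rewrite indicE in_setI; case: (boolP (w \in kappa @^-1` _)) => //.
  by rewrite inE/= => e; rewrite e eqxx in cw.
rewrite sumP; last exact: mpre.
under eq_bigr => c _ do rewrite probability_fiber1//.
rewrite -ge0_sume_distrl; last first.
  by move=> c _; rewrite -probability_fiber measure_ge0.
(* The total mass of [r] comes from the same decomposition, applied to the whole space. *)
rewrite (_ : (\sum_c (r c)%:E = 1)%E) ?mul1e//.
rewrite -(@probability_setT _ _ _ P) sumP//.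
by apply: eq_bigr => c _; rewrite setIT probability_fiber.
Qed.

Lemma integrable_marginal i (f : S -> R) :
  measurable_fun setT f -> mu.-integrable setT (EFin \o f) ->
  P.-integrable setT (EFin \o (f \o X i)) /\
  (\int[P]_w (f (X i w))%:E = \int[mu]_x (f x)%:E)%E.
Proof.
move=> mf intf.
have mXi := mX i.
pose Y : {RV P >-> S} := HB.pack (X i) (isMeasurableFun.Build _ _ _ _ _ mXi).
have intE h : (\int[distribution P Y]_z h z = \int[mu]_z h z)%E.
  by apply: eq_measure_integral => A mA _; exact: probability_marginal.
have i1 : P.-integrable setT (EFin \o (f \o X i)).
  apply/integrableP; split.
    by apply/measurable_EFinP; exact: measurableT_comp.
  have /integrableP[_] := intf; rewrite -intE ge0_integral_distribution//.
  by apply: measurableT_comp => //; exact/measurable_EFinP.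
split => //; rewrite -intE integral_distribution//.
exact/measurable_EFinP.
Qed.

Context (psi : S -> R).
Hypothesis mpsi : measurable_fun setT psi.
Hypothesis ipsi2 : mu.-integrable setT (EFin \o (fun x => psi x ^+ 2)).

Let a := fine (\int[mu]_x (psi x)%:E)%E.
Let s := fine (\int[mu]_x (psi x ^+ 2)%:E)%E.

Let ipsi : mu.-integrable setT (EFin \o psi).
Proof. exact: integrable_of_sqr. Qed.

(** The mark is independent of the data, so [r c] factors out. What remains is the second moment [s]
    on the diagonal and, by independence of distinct coordinates, the squared mean [a * a] off
    it. *)
Lemma fiber_moment i l c :
  P.-integrable setT (EFin \o (fun w => \1_(kappa @^-1` [set c]) w *
    (psi (X i w) * psi (X l w)))) /\
  (\int[P]_w (\1_(kappa @^-1` [set c]) w * (psi (X i w) * psi (X l w)))%:E =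
   (r c * (if i == l then s else a * a))%:E)%E.
Proof.
have mc A (f : S -> R) : measurable_fun setT f -> measurable A ->
    measurable (f @^-1` A).
  by move=> mf mA; rewrite -[X in measurable X]setTI; exact: mf.
case: eqVneq => [<-|il].
  have mpsi2 : measurable_fun setT (fun x => psi x ^+ 2) by exact: measurable_funX.
  have [i2 E2] := integrable_marginal i _ mpsi2 ipsi2.
  (* On the diagonal the square is taken as a single factor and paired with the constant 1, which is
     independent of everything. *)
  have [||||||] := @integral_indic_mul_indep R d T P (kappa @^-1` [set c])
    (fun w => psi (X i w) ^+ 2) (cst 1).
  - exact: mkappa.
  - exact: (measurableT_comp mpsi2 (mX i)).
  - exact: measurable_cst.
  - exact: i2.
  - exact: finite_measure_integrable_cst.
  - move=> A B mA mB; rewrite preimage_cst; case: ifP => _.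
      rewrite setIT probability_setT mule1 probability_fiber.
      rewrite (probability_fiber1 i c ((fun x => psi x ^+ 2) @^-1` A)).
        rewrite -(probability_marginal i)//; exact: mc.
      exact: mc.
    by rewrite !setI0 measure0 !mule0.
  - move=> i1 e1; split.
      by apply: eq_integrable i1 => // w _ /=; rewrite mulr1.
    under eq_integral => w _ do rewrite -expr2 -[_ ^+ 2]mulr1.
    have c1 : (\int[P]_w (cst (1 : R) w)%:E = 1)%E.
      by have := expectation_cst P 1; rewrite unlock.
    rewrite e1 E2 probability_fiber c1 mule1 EFinM.
    by rewrite /s fineK//; exact: integrable_fin_num.
have [ii Ei] := integrable_marginal i _ mpsi ipsi.
have [il' El] := integrable_marginal l _ mpsi ipsi.
have [||||||i1 e1] := @integral_indic_mul_indep R d T P (kappa @^-1` [set c])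
  (psi \o X i) (psi \o X l).
- exact: mkappa.
- exact: measurableT_comp.
- exact: measurableT_comp.
- exact: ii.
- exact: il'.
- move=> A B mA mB; rewrite probability_fiber.
  rewrite (probability_fiber2 i l c (psi @^-1` A) (psi @^-1` B))//; [|exact: mc..].
  by rewrite -(probability_marginal i) -?(probability_marginal l)//; exact: mc.
- split; first exact: i1.
  rewrite e1 /= Ei El probability_fiber EFinM; congr (_ * _)%E.
  by rewrite EFinM /a fineK//; exact: integrable_fin_num.
Qed.

(** On each fibre of the mark the weights are constants, so expanding the square reduces the second
    moment to the fiber moments. *)
Lemma MSE_weighted_sum (W : K -> 'I_n -> R) (G : T -> R) :
  (forall w, G w = \sum_i W (kappa w) i * psi (X i w)) ->
  MSE P G = (\sum_c r c * ((s - a * a) * \sum_i W c i ^+ 2 +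
                           a * a * (\sum_i W c i) ^+ 2))%:E.
Proof.
move=> GE.
have indE c w : \1_(kappa @^-1` [set c]) w = (kappa w == c)%:R :> R.
  rewrite indicE (_ : (w \in _) = (kappa w == c))//.
  apply/idP/eqP; first by rewrite inE.
  by move=> h; apply/mem_set.
(* Cutting [G] along the finitely many fibres of [kappa] turns the random weights into constants,
   and measurability follows term by term. *)
have mG : measurable_fun setT G.
  have -> : G = fun w => \sum_c \sum_i \1_(kappa @^-1` [set c]) w *
      (W c i * psi (X i w)).
    apply/funext => w; rewrite GE (bigD1 (kappa w))//= [X in _ + X]big1.
      by rewrite addr0; apply: eq_bigr => i _; rewrite indE eqxx mul1r.
    move=> c cw; rewrite big1// => i _.
    by rewrite indE eq_sym (negPf cw) mul0r.
  apply: measurable_sum => c; apply: measurable_sum => i.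
  apply: measurable_funM; first exact: measurable_indic.
  by apply: measurable_funM => //; exact: measurableT_comp.
pose F c i l w : \bar R := ((W c i * W c l)%:E *
  (\1_(kappa @^-1` [set c]) w * (psi (X i w) * psi (X l w)))%:E)%E.
(* At each [w] only the term [c = kappa w] of the outer sum survives. *)
have G2E w : (G w ^+ 2)%:E = (\sum_c \sum_i \sum_l F c i l w)%E.
  rewrite (bigD1 (kappa w))//= [X in (_ + X)%E]big1 ?adde0.
    rewrite /F GE expr2 big_distrlr/= -sumEFin; apply: eq_bigr => i _.
    rewrite -sumEFin; apply: eq_bigr => l _.
    by rewrite indE eqxx mul1r -EFinM mulrACA.
  move=> c cw; rewrite big1// => i _; rewrite big1// => l _.
  by rewrite /F indE eq_sym (negPf cw) mul0r mule0.
have iF c i l : P.-integrable setT (F c i l).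
  by apply: integrableZl => //; exact: (fiber_moment i l c).1.
have iG : P.-integrable setT (EFin \o (fun w => G w ^+ 2)).
  rewrite (_ : _ \o _ = fun w => \sum_c \sum_i \sum_l F c i l w)%E; last first.
    by apply/funext => w; exact: G2E.
  apply: integrable_sum => // c _; apply: integrable_sum => // i _.
  by apply: integrable_sum => // l _.
rewrite MSE_sqr//.
under eq_integral => w _ do rewrite G2E.
rewrite integral_sum//; last first.
  move=> c; apply: integrable_sum => // i _.
  by apply: integrable_sum => // l _.
rewrite -sumEFin; apply: eq_bigr => c _.
rewrite integral_sum//; last first.
  by move=> i; apply: integrable_sum => // l _.
transitivity (\sum_i \sum_l (W c i * W c l * (r c * (if i == l then s else a * a)))%:E)%E.
  apply: eq_bigr => i _; rewrite integral_sum//.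
  apply: eq_bigr => l _; have [iil eil] := fiber_moment i l c.
  by rewrite /F integralZl// eil EFinM.
under eq_bigr do rewrite sumEFin.
rewrite sumEFin; congr EFin.
(* The squared total accounts for every pair with moment [a * a]; on the diagonal the moment is [s],
   and the excess gives the coefficient [s - a * a]. *)
have -> : (\sum_i W c i) ^+ 2 = \sum_i \sum_l W c i * W c l.
  by rewrite expr2 big_distrlr.
rewrite !mulr_sumr -big_split/= mulr_sumr; apply: eq_bigr => i _.
rewrite (bigD1 i)//= eqxx [in RHS](bigD1 i)//= mulrDr.
rewrite (eq_bigr (fun l => r c * (a * a * (W c i * W c l)))); last first.
  by move=> l il; rewrite eq_sym (negPf il); ring.
by rewrite -!mulr_sumr; ring.
Qed.

End discrete_mark.

(** * Expectations under a finite product distribution *)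

Section product_pmf.
Context {R : comNzRingType} {I J : finType} (rho : J -> R).
Hypothesis rho1 : \sum_x rho x = 1.

(** Distributivity turns the sum over all functions into a product of sums, one per coordinate. *)
Lemma sum_prod_pmf : \sum_(c : {ffun I -> J}) \prod_t rho (c t) = 1.
Proof.
rewrite -(bigA_distr_bigA (fun (t : I) (x : J) => rho x)).
by rewrite big1.
Qed.

(** The factor [g] is absorbed into coordinate [t0]; every other coordinate sums to 1. *)
Lemma sum_prod_pmf1 t0 (g : J -> R) :
  \sum_(c : {ffun I -> J}) (\prod_t rho (c t)) * g (c t0) =
  \sum_x rho x * g x.
Proof.
pose F (t : I) x := rho x * (if t == t0 then g x else 1).
transitivity (\sum_(c : {ffun I -> J}) \prod_t F t (c t)).
  apply: eq_bigr => c _; rewrite big_split/=; congr (_ * _).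
  by rewrite (bigD1 t0)//= eqxx big1 ?mulr1// => t /negPf ->.
rewrite -(bigA_distr_bigA F) (bigD1 t0)//= [X in _ * X]big1 ?mulr1.
  by apply: eq_bigr => x _; rewrite /F eqxx.
move=> t /negPf tt0; rewrite -[RHS]rho1; apply: eq_bigr => x _.
by rewrite /F tt0 mulr1.
Qed.

(** As for one coordinate: since [t0] and [t1] differ, [g] and [h] are absorbed into separate
    factors. *)
Lemma sum_prod_pmf2 t0 t1 (g h : J -> R) : t0 != t1 ->
  \sum_(c : {ffun I -> J}) (\prod_t rho (c t)) * (g (c t0) * h (c t1)) =
  (\sum_x rho x * g x) * (\sum_x rho x * h x).
Proof.
move=> t01; have t10 : t1 == t0 = false by rewrite eq_sym (negPf t01).
pose F (t : I) x :=
  rho x * (if t == t0 then g x else if t == t1 then h x else 1).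
transitivity (\sum_(c : {ffun I -> J}) \prod_t F t (c t)).
  apply: eq_bigr => c _; rewrite big_split/=; congr (_ * _).
  rewrite (bigD1 t0)//= eqxx (bigD1 t1) ?t10//= eqxx big1 ?mulr1//.
  by move=> t /andP[/negPf -> /negPf ->].
rewrite -(bigA_distr_bigA F) (bigD1 t0)//= (bigD1 t1) ?t10//=.
rewrite [X in _ * (_ * X)]big1 ?mulr1.
  congr (_ * _); apply: eq_bigr => x _; rewrite /F ?eqxx//.
  by rewrite t10.
move=> t /andP[/negPf tt0 /negPf tt1]; rewrite -[RHS]rho1; apply: eq_bigr => x _.
by rewrite /F tt0 tt1 mulr1.
Qed.

End product_pmf.

(** * The statistic as a weighted sum, and the moments of its weights *)

Section sketch.
Context {R : realType}.

(* The coefficient of [U_i V_i] in the sketched statistic, given the outcome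
   [c] of the sampling. *)
Definition RS_weight {n m : nat} (c : 'I_m -> 'I_n) (i : 'I_n) : R :=
  Num.sqrt m%:R / n%:R * (n%:R / m%:R * (\sum_t (c t == i)%:R) - 1).

Definition BS_weight {n : nat} (m : nat) (c : 'I_n -> bool) (i : 'I_n) : R :=
  Num.sqrt m%:R / n%:R * (n%:R / m%:R * (c i)%:R - 1).

(** Each row of the sampling matrix has a single nonzero entry, so the sketched product is [n / m]
    times a sum over the draws. *)
Lemma sketch_stat_RS (n m : nat) (c : 'I_m -> 'I_n) (u v : 'I_n -> R) :
  sketch_stat m (RS_matrix c) (\col_i u i) (\col_i v i) =
  \sum_i RS_weight c i * (u i * v i).
Proof.
have s2 : Num.sqrt (n%:R / m%:R) ^+ 2 = n%:R / m%:R :> R.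
  by rewrite sqr_sqrtr// divr_ge0.
have e1 : ((\col_i u i)^T *m (RS_matrix c)^T *m RS_matrix c *m \col_i v i)
    ord0 ord0 = n%:R / m%:R * \sum_t u (c t) * v (c t) :> R.
  rewrite -trmx_mul -mulmxA mxE mulr_sumr; apply: eq_bigr => t _.
  rewrite mxE /RS_matrix -!scalemxAl !mxE -[in RHS]s2.
  rewrite (bigD1 (c t))//= big1 ?addr0; last first.
    by move=> i /negPf it; rewrite !mxE eq_sym it mul0r.
  rewrite [X in _ * (_ * X)](bigD1 (c t))//= [X in _ * (_ * (_ + X))]big1 ?addr0.
    by rewrite !mxE eqxx !mul1r mulrACA -expr2.
  by move=> i /negPf it; rewrite !mxE eq_sym it mul0r.
have e2 : ((\col_i u i)^T *m \col_i v i) ord0 ord0 = \sum_i u i * v i :> R.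
  by rewrite mxE; apply: eq_bigr => i _; rewrite !mxE.
rewrite /sketch_stat e1 e2 /RS_weight.
(* Grouping the draws by the index drawn produces the counts that enter the weights. *)
have -> : \sum_t u (c t) * v (c t) = \sum_i (\sum_t (c t == i)%:R) * (u i * v i).
  under [RHS]eq_bigr do rewrite mulr_suml.
  rewrite exchange_big/=; apply: eq_bigr => t _.
  rewrite (bigD1 (c t))//= eqxx mul1r big1 ?addr0// => i /negPf it.
  by rewrite eq_sym it mul0r.
rewrite mulr_sumr -sumrB mulr_sumr mulr_suml; apply: eq_bigr => i _.
ring.
Qed.

(** The matrix is diagonal and its 0-1 entries are idempotent, so squaring changes only the scale
    factor. *)
Lemma sketch_stat_BS (n m : nat) (c : 'I_n -> bool) (u v : 'I_n -> R) :
  sketch_stat m (BS_matrix m c) (\col_i u i) (\col_i v i) =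
  \sum_i BS_weight m c i * (u i * v i).
Proof.
have s2 : Num.sqrt (n%:R / m%:R) ^+ 2 = n%:R / m%:R :> R.
  by rewrite sqr_sqrtr// divr_ge0.
have e1 : ((\col_i u i)^T *m (BS_matrix m c)^T *m BS_matrix m c *m \col_i v i)
    ord0 ord0 = \sum_i n%:R / m%:R * ((c i)%:R * (u i * v i)) :> R.
  rewrite -trmx_mul -mulmxA mxE; apply: eq_bigr => t _.
  rewrite mxE /BS_matrix -!scalemxAl !mul_diag_mx !mxE -[in RHS]s2.
  by case: (c t); rewrite ?(mul1r, mul0r, mulr0)// mulrACA -expr2.
have e2 : ((\col_i u i)^T *m \col_i v i) ord0 ord0 = \sum_i u i * v i :> R.
  by rewrite mxE; apply: eq_bigr => i _; rewrite !mxE.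
rewrite /sketch_stat e1 e2 /BS_weight.
rewrite -sumrB mulr_sumr mulr_suml; apply: eq_bigr => i _.
ring.
Qed.

Lemma sum_RS_count (n m : nat) (c : 'I_m -> 'I_n) :
  \sum_i \sum_t (c t == i)%:R = m%:R :> R.
Proof.
rewrite exchange_big/= -[m in RHS]card_ord -sumr_const; apply: eq_bigr => t _.
by rewrite (bigD1 (c t))//= eqxx big1 ?addr0// => i /negPf; rewrite eq_sym => ->.
Qed.

(** The counts always total [m]. This exact cancellation removes the squared mean from the limit,
    leaving a variance in the case with replacement. *)
Lemma sum_RS_weight (n m : nat) (c : 'I_m -> 'I_n) :
  (0 < n)%N -> (0 < m)%N -> \sum_i RS_weight c i = 0.
Proof.
move=> n0 m0; rewrite -mulr_sumr sumrB -mulr_sumr sum_RS_count sumr_const card_ord.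
have ? : n%:R != 0 :> R by rewrite pnatr_eq0 -lt0n.
have ? : m%:R != 0 :> R by rewrite pnatr_eq0 -lt0n.
by rewrite divfK// subrr mulr0.
Qed.

(** After expanding the square, the cross terms sum to [-2 m / n] and the constants to [m / n],
    because the counts total [m]. *)
Lemma sum_RS_weight_sqr (n m : nat) (c : 'I_m -> 'I_n) :
  (0 < n)%N -> (0 < m)%N -> \sum_i RS_weight c i ^+ 2 =
  m%:R^-1 * (\sum_i (\sum_t (c t == i)%:R) ^+ 2) - m%:R / n%:R.
Proof.
move=> n0 m0.
have n0' : n%:R != 0 :> R by rewrite pnatr_eq0 -lt0n.
have m0' : m%:R != 0 :> R by rewrite pnatr_eq0 -lt0n.
have -> : \sum_i RS_weight c i ^+ 2 = \sum_i
   (m%:R^-1 * (\sum_t (c t == i)%:R) ^+ 2 - 2 / n%:R * (\sum_t (c t == i)%:R)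
    + m%:R / n%:R ^+ 2).
  apply: eq_bigr => i _; rewrite /RS_weight.
  rewrite exprMn expr_div_n sqr_sqrtr//.
  by field; rewrite n0' m0'.
rewrite big_split/= sumrB -!mulr_sumr sum_RS_count sumr_const card_ord.
rewrite -mulr_natr.
by field; rewrite n0' m0'.
Qed.

(** The sum of squared counts is the number of ordered pairs of draws that coincide. A draw
    coincides with itself surely, and with another draw with probability [\sum_i p i ^+ 2]. *)
Lemma expected_RS_weight_sqr (n m : nat) (p : 'I_n -> R) :
  (0 < n)%N -> (0 < m)%N -> \sum_i p i = 1 ->
  \sum_(c : {ffun 'I_m -> 'I_n}) (\prod_t p (c t)) * \sum_i RS_weight c i ^+ 2 =
  1 + (m%:R - 1) * (\sum_i p i ^+ 2) - m%:R / n%:R.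
Proof.
move=> n0 m0 p1.
have m0' : m%:R != 0 :> R by rewrite pnatr_eq0 -lt0n.
under eq_bigr do rewrite sum_RS_weight_sqr// mulrBr.
rewrite sumrB -mulr_suml sum_prod_pmf// mul1r; congr (_ - _).
under eq_bigr do rewrite mulrCA.
rewrite -mulr_sumr.
transitivity (m%:R^-1 * \sum_(t < m) \sum_(t' < m)
    (if t == t' then 1 else \sum_i p i ^+ 2)).
  congr (_ * _).
  have countE z (c : {ffun 'I_m -> 'I_n}) :
      z * \sum_i (\sum_t (c t == i)%:R) ^+ 2 =
      \sum_t \sum_t' \sum_i z * ((c t == i)%:R * (c t' == i)%:R) :> R.
    transitivity (\sum_i \sum_t \sum_t' z * ((c t == i)%:R * (c t' == i)%:R)).
      rewrite mulr_sumr; apply: eq_bigr => i _.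
      rewrite expr2 big_distrlr/= mulr_sumr; apply: eq_bigr => t _.
      by rewrite mulr_sumr.
    by rewrite exchange_big/=; apply: eq_bigr => t _; rewrite exchange_big.
  under eq_bigr do rewrite countE.
  rewrite exchange_big/=; apply: eq_bigr => t _.
  rewrite exchange_big/=; apply: eq_bigr => t' _.
  rewrite exchange_big/=; case: eqVneq => [<-|tt'].
    rewrite -[RHS]p1; apply: eq_bigr => i _.
    under eq_bigr do rewrite -natrM mulnb andbb.
    rewrite (sum_prod_pmf1 _ p1 t (fun x => (x == i)%:R)).
    rewrite (bigD1 i)//= eqxx mulr1 big1 ?addr0// => x /negPf ->.
    by rewrite mulr0.
  apply: eq_bigr => i _.
  rewrite (sum_prod_pmf2 _ p1 t t' (fun x => (x == i)%:R) (fun x => (x == i)%:R))//.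
  rewrite (bigD1 i)//= eqxx mulr1 big1 ?addr0 ?expr2// => x /negPf ->.
  by rewrite mulr0.
(* Each draw contributes one diagonal pair and [m - 1] off-diagonal ones. *)
transitivity (m%:R^-1 * \sum_(t < m) (1 + (m%:R - 1) * \sum_i p i ^+ 2)).
  congr (_ * _); apply: eq_bigr => t _.
  rewrite (bigD1 t)//= eqxx; congr (_ + _).
  rewrite (eq_bigr (fun=> \sum_i p i ^+ 2)); last first.
    by move=> t' /negPf; rewrite eq_sym => ->.
  by rewrite sumr_const cardC1 card_ord -[LHS]mulr_natl -subn1 natrB.
by rewrite sumr_const card_ord -[X in _ * X = _]mulr_natl mulKf.
Qed.

(** The weights are independent and centred, so the square of their sum and the sum of their squares
    have the same expectation, [n] times the variance [(1 - q) / n] of one weight. *)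
Lemma expected_BS_weights (n m : nat) (A B : R) (q := m%:R / n%:R : R) :
  (0 < n)%N -> (0 < m)%N ->
  \sum_(c : {ffun 'I_n -> bool}) (\prod_i (if c i then q else 1 - q)) *
    (A * \sum_i BS_weight m c i ^+ 2 + B * (\sum_i BS_weight m c i) ^+ 2) =
  (A + B) * (1 - q).
Proof.
move=> n0 m0.
have n0' : n%:R != 0 :> R by rewrite pnatr_eq0 -lt0n.
have m0' : m%:R != 0 :> R by rewrite pnatr_eq0 -lt0n.
pose rho (b : bool) : R := if b then q else 1 - q.
pose g (b : bool) : R := Num.sqrt m%:R / n%:R * (n%:R / m%:R * b%:R - 1).
have rho1 : \sum_b rho b = 1 by rewrite big_bool /rho/=; ring.
(* The scaling [n / m] is the inverse of the success probability [q], which centres the weight. *)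
have g1 : \sum_b rho b * g b = 0.
  rewrite big_bool /rho /g /q/=.
  by field; rewrite n0' m0'.
have g2 : \sum_b rho b * g b ^+ 2 = (1 - q) / n%:R.
  rewrite big_bool /rho /g /q/= !exprMn sqr_sqrtr//.
  by field; rewrite n0' m0'.
have E2 : \sum_(c : {ffun 'I_n -> bool}) (\prod_i rho (c i)) *
    (\sum_i BS_weight m c i ^+ 2) = 1 - q.
  under eq_bigr do rewrite mulr_sumr.
  rewrite exchange_big/=.
  under eq_bigr => i _.
    rewrite (sum_prod_pmf1 _ rho1 i (fun x => g x ^+ 2)) g2.
    over.
  by rewrite sumr_const card_ord -[LHS]mulr_natr divfK.
have E1 : \sum_(c : {ffun 'I_n -> bool}) (\prod_i rho (c i)) *
    (\sum_i BS_weight m c i) ^+ 2 = 1 - q.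
  have sqrE z (c : {ffun 'I_n -> bool}) : z * (\sum_i BS_weight m c i) ^+ 2 =
      \sum_i \sum_j z * (BS_weight m c i * BS_weight m c j).
    rewrite expr2 big_distrlr/= mulr_sumr; apply: eq_bigr => i _.
    by rewrite mulr_sumr.
  under eq_bigr do rewrite sqrE.
  rewrite exchange_big/=.
  transitivity (\sum_(i < n) (1 - q) / n%:R).
    apply: eq_bigr => i _; rewrite exchange_big/= (bigD1 i)//=.
    rewrite [X in _ + X]big1 ?addr0; last first.
      move=> j ji; rewrite eq_sym in ji.
      by rewrite (sum_prod_pmf2 _ rho1 i j g g)// g1 mul0r.
    under eq_bigr do rewrite -expr2.
    by rewrite (sum_prod_pmf1 _ rho1 i (fun x => g x ^+ 2)) g2.
  by rewrite sumr_const card_ord -[LHS]mulr_natr divfK.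
under eq_bigr do rewrite mulrDr (mulrCA _ A) (mulrCA _ B).
rewrite big_split/= -!mulr_sumr.
rewrite [X in A * X]E2 [X in B * X]E1.
by rewrite mulrDl.
Qed.

End sketch.

(** * Measurability of the sampling outcome and integrability of the data *)

(** A fibre of the whole outcome is a finite intersection of fibres of its coordinates; this lets
    the outcome serve as a single mark. *)
Lemma measurable_ffun_fiber {d : measure_display} {T : measurableType d}
  {I J : finType} (k : I -> T -> J) (c : {ffun I -> J}) :
  (forall t j, measurable (k t @^-1` [set j])) ->
  measurable ((fun w => [ffun t => k t w]) @^-1` [set c]).
Proof.
move=> mk.
rewrite (_ : _ @^-1` _ = \bigcap_(t in [set: I]) k t @^-1` [set c t]).
  by apply: fin_bigcap_measurable.
apply/seteqP; split => w /=; first by move=> <- t _ /=; rewrite ffunE.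
by move=> h; apply/ffunP => t; rewrite ffunE; exact: h.
Qed.

(** Expanding [(x^2 - y^2)^2 >= 0] bounds [x^2 y^2] by [x^4 + y^4]. *)
Lemma integrable_sqr_mul {R : realType} (mu : probability (R * R)%type R) :
  (\int[mu]_x (x.1 ^+ 4)%:E < +oo)%E -> (\int[mu]_x (x.2 ^+ 4)%:E < +oo)%E ->
  mu.-integrable setT (EFin \o (fun x => (x.1 * x.2) ^+ 2)).
Proof.
move=> h1 h2.
have m1 : measurable_fun setT (fun x : (R * R)%type => x.1 ^+ 4).
  exact: measurable_funX.
have m2 : measurable_fun setT (fun x : (R * R)%type => x.2 ^+ 4).
  exact: measurable_funX.
have ev4 (x : R) : 0 <= x ^+ 4 by rewrite exprn_even_ge0.
have i1 : mu.-integrable setT (EFin \o (fun x => x.1 ^+ 4)).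
  apply/integrableP; split; first exact/measurable_EFinP.
  by under eq_integral => x _ do rewrite /= ger0_norm//.
have i2 : mu.-integrable setT (EFin \o (fun x => x.2 ^+ 4)).
  apply/integrableP; split; first exact/measurable_EFinP.
  by under eq_integral => x _ do rewrite /= ger0_norm//.
apply: le_integrable (integrableD measurableT i1 i2) => //.
  apply/measurable_EFinP; apply: measurable_funX.
  exact: measurable_funM.
move=> x _ /=; rewrite lee_fin ger0_norm ?sqr_ge0//.
rewrite ger0_norm ?addr_ge0//.
have := sqr_ge0 (x.1 ^+ 2 - x.2 ^+ 2).
have := sqr_ge0 (x.1 * x.2).
have -> : x.1 ^+ 4 = (x.1 ^+ 2) ^+ 2 by rewrite -exprM.
have -> : x.2 ^+ 4 = (x.2 ^+ 2) ^+ 2 by rewrite -exprM.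
rewrite exprMn; nra.
Qed.

(** * Passage to the limit under both sampling schemes *)

Theorem theorem3p1 (R : realType) (mu : probability (R * R)%type R)
  (hU4 : (\int[mu]_x (x.1 ^+ 4)%:E < +oo)%E)
  (hV4 : (\int[mu]_x (x.2 ^+ 4)%:E < +oo)%E)
  (m : nat -> nat)
  (hm_inf : forall N : nat, \forall n \near \oo, (N <= m n)%N)
  (hm_o : ((m n)%:R / n%:R : R) @[n --> \oo] --> 0) :
  (* (i) random sampling with replacement *)
  (forall (d : nat -> measure_display) (T : forall n, measurableType (d n))
     (P : forall n, probability (T n) R)
     (U V : forall n, 'I_n -> T n -> R) (p : forall n, 'I_n -> R)
     (k : forall n, 'I_(m n) -> T n -> 'I_n),
     (forall n i, measurable_fun setT (U n i)) ->
     (forall n i, measurable_fun setT (V n i)) ->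
     (forall n t j, measurable (k n t @^-1` [set j])) ->
     (forall n, (0 < n)%N ->
        (forall i, 0 <= p n i) /\ \sum_(i < n) p n i = 1 /\
        RS_joint_law (P n) mu (U n) (V n) (p n) (k n)) ->
     ((m n)%:R * \sum_(i < n) p n i ^+ 2 : R) @[n --> \oo] --> 0 ->
     MSE (P n) (fun w => sketch_stat (m n)
        (RS_matrix (fun t => k n t w))
        (\col_(i < n) U n i w) (\col_(i < n) V n i w))
       @[n --> \oo] --> ('V_mu[(fun x : R * R => x.1 * x.2)%R])%E)
  /\
  (* (ii) Bernoulli sampling *)
  (forall (d : nat -> measure_display) (T : forall n, measurableType (d n))
     (P : forall n, probability (T n) R)
     (U V : forall n, 'I_n -> T n -> R)
     (b : forall n, 'I_n -> T n -> bool),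
     (forall n i, measurable_fun setT (U n i)) ->
     (forall n i, measurable_fun setT (V n i)) ->
     (forall n i, measurable (b n i @^-1` [set true])) ->
     (forall n, (0 < n)%N -> (m n <= n)%N ->
        BS_joint_law (P n) mu ((m n)%:R / n%:R) (U n) (V n) (b n)) ->
     MSE (P n) (fun w => sketch_stat (m n)
        (BS_matrix (m n) (fun i => b n i w))
        (\col_(i < n) U n i w) (\col_(i < n) V n i w))
       @[n --> \oo] --> ('E_mu[(fun x : R * R => (x.1 * x.2) ^+ 2)%R])%E).
Proof.
pose psi (x : R * R) := x.1 * x.2.
have mpsi : measurable_fun setT psi by exact: measurable_funM.
have ipsi2 : mu.-integrable setT (EFin \o (fun x => psi x ^+ 2)).
  exact: integrable_sqr_mul.
have ipsi := integrable_of_sqr _ _ mpsi ipsi2.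
pose a := fine (\int[mu]_x (psi x)%:E)%E.
pose s := fine (\int[mu]_x (psi x ^+ 2)%:E)%E.
have aE : (\int[mu]_x (psi x)%:E)%E = a%:E.
  by rewrite fineK//; exact: integrable_fin_num.
have sE : (\int[mu]_x (psi x ^+ 2)%:E)%E = s%:E.
  by rewrite fineK//; exact: integrable_fin_num.
split.
- move=> d T P U V p k mU mV mk law hp.
  have -> : 'V_mu[psi]%E = (s - a * a)%:E.
    rewrite /variance covarianceE ?EFinB ?EFinM; [|exact/Lfun1_integrable..].
    by rewrite -aE -sE unlock.
  (* The closed form of the MSE, valid once [n] and [m n] are positive. *)
  pose v n : R := (s - a * a) *
    (1 + ((m n)%:R - 1) * (\sum_(i < n) p n i ^+ 2) - (m n)%:R / n%:R).
  have vcvg : v n @[n --> \oo] --> s - a * a.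
    rewrite /v -[X in _ --> X]mulr1; apply: cvgM; first exact: cvg_cst.
    rewrite -[X in _ --> X]subr0 -[X in _ --> X - _]addr0.
    apply: cvgB => //; apply: cvgD; first exact: cvg_cst.
    rewrite -[X in _ --> X]subr0.
    under eq_fun do rewrite mulrBl mul1r.
    apply: cvgB => //.
    (* Eventually [m n >= 1], so the sum of the squared probabilities lies between 0 and [m n] times
       itself, which tends to 0. *)
    apply: (squeeze_cvgr _ (cvg_cst 0) hp).
    near=> n; apply/andP; split; first by apply: sumr_ge0 => i _; exact: sqr_ge0.
    rewrite ler_peMl//; first by apply: sumr_ge0 => i _; exact: sqr_ge0.
    by rewrite ler1n; near: n; exact: hm_inf.
  have : (v n)%:E @[n --> \oo] --> (s - a * a)%:E.
    by apply: cvg_EFin => //; exact: nearW.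
  (* It remains to identify the MSE with [v n] for large [n], where no denominator vanishes. *)
  apply: cvg_trans; apply: near_eq_cvg; near=> n.
  have n0 : (0 < n)%N by near: n; exact: nbhs_infty_gt.
  have m0 : (0 < m n)%N by near: n; exact: hm_inf.
  have [p0 [p1 lawn]] := law n n0.
  pose X i w := (U n i w, V n i w).
  pose kappa w : {ffun 'I_(m n) -> 'I_n} := [ffun t => k n t w].
  pose r (c : {ffun 'I_(m n) -> 'I_n}) := \prod_t p n (c t).
  have mX i : measurable_fun setT (X i) by exact: measurable_fun_pair.
  have mkappa c : measurable (kappa @^-1` [set c]) by exact: measurable_ffun_fiber.
  have lawX (A : 'I_n -> set (R * R)) c : (forall i, measurable (A i)) ->
      P n [set w | (forall i, A i (X i w)) /\ kappa w = c] =
      ((\prod_(i < n) mu (A i)) * (r c)%:E)%E.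
    move=> mA; rewrite /r -prodEFin -lawn//; congr (P n _).
    apply/seteqP; split => w /= [hA hk]; split => //.
      by move=> t; rewrite -hk ffunE.
    by apply/ffunP => t; rewrite ffunE.
  rewrite (MSE_weighted_sum (P n) mu X kappa r mX mkappa lawX psi mpsi ipsi2
    (fun c => RS_weight c)); last first.
    move=> w; rewrite sketch_stat_RS; apply: eq_bigr => i _; congr (_ * _).
    by rewrite /RS_weight; under [in RHS]eq_bigr do rewrite ffunE.
  rewrite -/a -/s /v -(expected_RS_weight_sqr _ _ _ n0 m0 p1) mulr_sumr.
  congr EFin; apply: eq_bigr => c _.
  (* The weights sum to zero for every outcome, so the [a * a] term drops out. *)
  by rewrite sum_RS_weight// expr0n/= mulr0 addr0 mulrCA.
- move=> d T P U V b mU mV mb law.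
  have -> : 'E_mu[(fun x : R * R => (x.1 * x.2) ^+ 2)%R]%E = s%:E.
    by rewrite unlock -sE.
  have vcvg : s * (1 - (m n)%:R / n%:R) @[n --> \oo] --> s.
    rewrite -[X in _ --> X]mulr1; apply: cvgM; first exact: cvg_cst.
    rewrite -[X in _ --> X]subr0; apply: cvgB => //; exact: cvg_cst.
  have : (s * (1 - (m n)%:R / n%:R))%:E @[n --> \oo] --> s%:E.
    by apply: cvg_EFin => //; exact: nearW.
  apply: cvg_trans; apply: near_eq_cvg; near=> n.
  have n0 : (0 < n)%N by near: n; exact: nbhs_infty_gt.
  have m0 : (0 < m n)%N by near: n; exact: hm_inf.
  (* [m n / n] tends to 0, hence is eventually at most 1 and a legitimate Bernoulli parameter. *)
  have mn : (m n <= n)%N.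
    have : (m n)%:R / n%:R <= 1 :> R.
      near: n; apply: (cvgr_le 0) => //.
    by rewrite ler_pdivrMr ?ltr0n// mul1r ler_nat.
  have lawn := law n n0 mn.
  pose X i w := (U n i w, V n i w).
  pose kappa w : {ffun 'I_n -> bool} := [ffun i => b n i w].
  pose q : R := (m n)%:R / n%:R.
  pose r (c : {ffun 'I_n -> bool}) : R := \prod_i (if c i then q else 1 - q).
  have mX i : measurable_fun setT (X i) by exact: measurable_fun_pair.
  have mkappa c : measurable (kappa @^-1` [set c]).
    apply: measurable_ffun_fiber => i [] //.
    rewrite (_ : _ @^-1` _ = ~` (b n i @^-1` [set true])).
      exact: measurableC.
    by apply/seteqP; split => w /=; case: (b n i w).
  have lawX (A : 'I_n -> set (R * R)) c : (forall i, measurable (A i)) ->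
      P n [set w | (forall i, A i (X i w)) /\ kappa w = c] =
      ((\prod_(i < n) mu (A i)) * (r c)%:E)%E.
    move=> mA; rewrite /r -prodEFin -lawn//; congr (P n _).
    apply/seteqP; split => w /= [hA hk]; split => //.
      by move=> t; rewrite -hk ffunE.
    by apply/ffunP => t; rewrite ffunE.
  rewrite (MSE_weighted_sum (P n) mu X kappa r mX mkappa lawX psi mpsi ipsi2
    (fun c => BS_weight (m n) c)); last first.
    move=> w; rewrite sketch_stat_BS; apply: eq_bigr => i _; congr (_ * _).
    by rewrite /BS_weight ffunE.
  (* With coefficients [s - a * a] and [a * a], the sum of the two is the second moment [s]. *)
  by rewrite -/a -/s expected_BS_weights// subrK.
Unshelve. all: by end_near.
Qed.
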